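(* Let $H$ and $K$ be Hopf algebras over $\mathbb K$, let $A$ be a $(K,H)$-bicomodule algebra such that $B=A^{coH}$ is a $K$-subcomodule of $A$, and let $\sigma:K\otimes K\to\mathbb K$ be a 2-cocycle on $K$. Then $B\subseteq A$ is an $H$-Hopf-Galois extension if and only if ${}_\sigma B\subseteq{}_\sigma A$ is an $H$-Hopf-Galois extension.
   Context: $\mathbb K$ is a commutative ring with unit, $\otimes=\otimes_{\mathbb K}$; Sweedler notation $\Delta(h)=h_{(1)}\otimes h_{(2)}$, right $H$-coactions $\delta(v)=v_{(0)}\otimes v_{(1)}$, left $K$-coactions $\rho(v)=v_{(-1)}\otimes v_{(0)}$. A $(K,H)$-bicomodule algebra is a unital associative algebra with a left $K$-coaction $\rho$ and a right $H$-coaction $\delta$, both unital algebra maps, with $(\rho\otimes\mathrm{id})\delta=(\mathrm{id}\otimes\delta)\rho$. $A^{coH}=\{b\in A:\delta^A(b)=b\otimes1_H\}$. That $B$ is a $K$-subcomodule means $\rho^A$ restricts to a left $K$-coaction $B\to K\otimes B$. For a right $H$-comodule algebra $A$ with $B=A^{coH}$, the extension $B\subseteq A$ is $H$-Hopf-Galois if the canonical map $A\otimes_BA\to A\otimes H$, $a\otimes_Ba'\mapsto aa'_{(0)}\otimes a'_{(1)}$ is bijective. A 2-cocycle on $K$ is a convolution invertible $\mathbb K$-linear map $\sigma:K\otimes K\to\mathbb K$ with $\sigma(k\otimes1)=\varepsilon(k)=\sigma(1\otimes k)$ and $\sigma(g_{(1)}\otimes h_{(1)})\sigma(g_{(2)}h_{(2)}\otimes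 k)=\sigma(h_{(1)}\otimes k_{(1)})\sigma(g\otimes h_{(2)}k_{(2)})$ for all $g,h,k\in K$. ${}_\sigma A$ is the right $H$-comodule algebra with the module, unit and right $H$-coaction of $A$ and product $a\,{}_\sigma\!\bullet\,a'=\sigma(a_{(-1)}\otimes a'_{(-1)})a_{(0)}a'_{(0)}$; ${}_\sigma B=({}_\sigma A)^{coH}$ is $B$ with this product. *)

(* Defs.v *)
From HB Require Import structures.
From mathcomp Require Import all_boot all_algebra.
From mathcomp Require Import boolp.

Set Implicit Arguments.
Unset Strict Implicit.
Unset Printing Implicit Defensive.

Import GRing.Theory.
Local Open Scope ring_scope.

(* A balanced tensor product of abelian groups M (with a right action of S)    *)
(* and N (with a left action of S): finite formal sums of pairs, as sequences, *)
(* modulo the congruence generated by biadditivity and m.b (x) n = m (x) b.n.  *)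
(* The rule tens_zero makes the quotient of sequences a group, with opposite   *)
(* - (m (x) n) = (- m) (x) n.                                                  *)
Section BalancedTensor.
Variables (M N : zmodType) (S : Type).
Variables (ract : M -> S -> M) (lact : S -> N -> N).

Inductive tens_rel : seq (M * N) -> seq (M * N) -> Prop :=
| tens_refl s : tens_rel s s
| tens_sym s t : tens_rel s t -> tens_rel t s
| tens_trans s t u : tens_rel s t -> tens_rel t u -> tens_rel s u
| tens_cat s s' t t' :
    tens_rel s s' -> tens_rel t t' -> tens_rel (s ++ t) (s' ++ t')
| tens_catC s t : tens_rel (s ++ t) (t ++ s)
| tens_zero n : tens_rel [:: (0, n)] [::]
| tens_addl m m' n : tens_rel [:: (m + m', n)] [:: (m, n); (m', n)]
| tens_addr m n n' : tens_rel [:: (m, n + n')] [:: (m, n); (m, n')]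
| tens_bal m b n : tens_rel [:: (ract m b, n)] [:: (m, lact b n)].

Definition tens_relb (s t : seq (M * N)) : bool := `[< tens_rel s t >].

Fact tens_relb_equiv : equiv_class_of tens_relb.
Proof.
split=> [s|s t|t s u].
- exact/asboolP/tens_refl.
- by apply/asboolP/asboolP; apply: tens_sym.
- by move=> /asboolP st /asboolP tu; apply/asboolP; apply: tens_trans st tu.
Qed.

Canonical tens_equiv := EquivRelPack tens_relb_equiv.

Definition btens : Type := {eq_quot tens_equiv}%qT.

HB.instance Definition _ := Choice.on btens.

Definition tclass (s : seq (M * N)) : btens := (\pi_{eq_quot tens_equiv} s)%qT.
Definition trepr (t : btens) : seq (M * N) :=
  (repr (t : {eq_quot tens_equiv}))%qT.

Lemma treprK t : tclass (trepr t) = t.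
Proof. exact: reprK. Qed.

Lemma tclassP s t : tclass s = tclass t <-> tens_rel s t.
Proof.
by split=> [/eqquotP/asboolP|] // st; apply/eqquotP/asboolP.
Qed.

Lemma trepr_class s : tens_rel (trepr (tclass s)) s.
Proof. by apply/tclassP; rewrite treprK. Qed.

Definition tadd (t u : btens) : btens := tclass (trepr t ++ trepr u).
Definition topp (t : btens) : btens :=
  tclass [seq (- p.1, p.2) | p <- trepr t].

Lemma tclass_cat s t : tclass (s ++ t) = tadd (tclass s) (tclass t).
Proof.
by apply/tclassP/tens_cat; apply/tens_sym/trepr_class.
Qed.

Fact taddA : associative tadd.
Proof.
move=> t u v; rewrite -(treprK t) -(treprK u) -(treprK v).
by rewrite -!tclass_cat catA.
Qed.

Fact taddC : commutative tadd.
Proof. by move=> t u; apply/tclassP/tens_catC. Qed.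

Fact tadd0 : left_id (tclass [::]) tadd.
Proof. by move=> t; rewrite -{1}(treprK t) -tclass_cat treprK. Qed.

Fact taddN : left_inverse (tclass [::]) topp tadd.
Proof.
move=> t; rewrite -{2}(treprK t) -tclass_cat.
elim: (trepr t) => [//|[m n] s IHs] /=.
set X := [seq _ | p <- s] in IHs *.
rewrite -cat1s -(cat1s (m, n) s) !tclass_cat (taddA (tclass X)).
rewrite (taddC (tclass X)) -taddA taddA -(tclass_cat X) IHs taddC tadd0.
rewrite -tclass_cat.
by apply/tclassP/(tens_trans _ (tens_zero n))/tens_sym; rewrite -(addNr m);
  apply: tens_addl.
Qed.

HB.instance Definition _ := GRing.isZmodule.Build btens taddA taddC tadd0 taddN.

Definition btensor (m : M) (n : N) : btens := tclass [:: (m, n)].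

Lemma btensDl m m' n : btensor (m + m') n = btensor m n + btensor m' n.
Proof. by rewrite /btensor -[RHS]tclass_cat; apply/tclassP/tens_addl. Qed.

Lemma btensDr m n n' : btensor m (n + n') = btensor m n + btensor m n'.
Proof. by rewrite /btensor -[RHS]tclass_cat; apply/tclassP/tens_addr. Qed.

Lemma btens_bal m b n : btensor (ract m b) n = btensor m (lact b n).
Proof. exact/tclassP/tens_bal. Qed.

(* swd t f is the sum of the f m n over a chosen representative of t as a sum  *)
(* of pure tensors m (x) n.  For balanced f it does not depend on that choice: *)
(* it is the additive map on the tensor product induced by f (swdE, swdD).     *)
Definition swd (V : zmodType) (t : btens) (f : M -> N -> V) : V :=
  \sum_(p <- trepr t) f p.1 p.2.

Definition balanced (V : zmodType) (f : M -> N -> V) : Prop :=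
  [/\ forall m m' n, f (m + m') n = f m n + f m' n,
      forall m n n', f m (n + n') = f m n + f m n'
    & forall m b n, f (ract m b) n = f m (lact b n)].

Lemma swd_class (V : zmodType) (f : M -> N -> V) : balanced f ->
  forall s, swd (tclass s) f = \sum_(p <- s) f p.1 p.2.
Proof.
case=> fDl fDr fbal s; rewrite /swd.
have: tens_rel (trepr (tclass s)) s by exact: trepr_class.
move: (trepr _) => s'; elim=> {s s'} //.
- by move=> s t u _ -> _ ->.
- by move=> s s' t t' _ IHs _ IHt; rewrite !big_cat /= IHs IHt.
- by move=> s t; rewrite !big_cat /= addrC.
- move=> n; rewrite big_seq1 big_nil /=.
  by apply: (addIr (f 0 n)); rewrite -fDl !add0r.
- by move=> m m' n; rewrite !big_cons !big_nil !addr0 /= fDl.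
- by move=> m n n'; rewrite !big_cons !big_nil !addr0 /= fDr.
- by move=> m b n; rewrite !big_seq1 /= fbal.
Qed.

Lemma swdE (V : zmodType) (f : M -> N -> V) m n :
  balanced f -> swd (btensor m n) f = f m n.
Proof. by move=> fP; rewrite swd_class // big_seq1. Qed.

Lemma swdD (V : zmodType) (f : M -> N -> V) t u :
  balanced f -> swd (t + u) f = swd t f + swd u f.
Proof.
by move=> fP; rewrite -{1}(treprK t) -{1}(treprK u) -[_ + _]tclass_cat
  swd_class // big_cat.
Qed.

Lemma swd_btensor t : swd t btensor = t.
Proof.
rewrite -{2}(treprK t) /swd; elim: (trepr t) => [|[m n] s IHs].
  by rewrite big_nil.
by rewrite big_cons IHs -cat1s [RHS]tclass_cat.
Qed.

End BalancedTensor.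

Notation "\swd_ ( x , y <- t ) E" := (swd t (fun x y => E))
  (at level 41, E at level 41, x name, y name,
   format "'[' \swd_ ( x ,  y  <-  t ) '/  '  E ']'") : ring_scope.

(* Tensor product of modules over the commutative ground ring k. *)
Section Tensor.
Variable (k : comPzRingType).

Definition tens (M N : lmodType k) : Type :=
  btens (fun (m : M) (a : k) => a *: m) (fun (a : k) (n : N) => a *: n).

HB.instance Definition _ (M N : lmodType k) := GRing.Zmodule.on (tens M N).

Definition tensor (M N : lmodType k) (m : M) (n : N) : tens M N :=
  btensor _ _ m n.

End Tensor.

Arguments tens {k} (M N)%_type_scope.
Notation "M ⊗ N" := (tens M N) (at level 40, left associativity) : type_scope.
Notation "m ⊗ n" := (tensor m n) (at level 40, left associativity) : ring_scope.

Definition bilin (k : comPzRingType) (M N V : lmodType k) (f : M -> N -> V) :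
  Prop := (forall m, linear (f m)) /\ (forall n, linear (f^~ n)).

Section TensorTheory.
Variable k : comPzRingType.
Implicit Types M N V W : lmodType k.

Lemma linD M V (f : M -> V) : linear f -> {morph f : x y / x + y}.
Proof. by move=> fL x y; have := fL 1 x y; rewrite !scale1r. Qed.

Lemma lin0 M V (f : M -> V) : linear f -> f 0 = 0.
Proof.
by move=> fL; apply: (addIr (f 0)); rewrite -linD // !add0r.
Qed.

Lemma linZ M V (f : M -> V) : linear f -> forall a x, f (a *: x) = a *: f x.
Proof. by move=> fL a x; have := fL a x 0; rewrite !addr0 (lin0 fL) addr0. Qed.

Lemma bilin_balanced M N V (f : M -> N -> V) : bilin f ->
  balanced (fun m (a : k) => a *: m) (fun (a : k) n => a *: n) f.
Proof.
case=> fr fl; split.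
- by move=> m m' n; rewrite (linD (fl n)).
- by move=> m n n'; rewrite (linD (fr m)).
- by move=> m a n; rewrite (linZ (fl n)) (linZ (fr m)).
Qed.

Definition tscale M N (a : k) (t : M ⊗ N) : M ⊗ N := \swd_(m, n <- t) (a *: m) ⊗ n.

Let tscale_bal M N a : balanced (fun m (a : k) => a *: m)
  (fun (a : k) n => a *: n) (fun (m : M) (n : N) => (a *: m) ⊗ n).
Proof.
split=> *.
- by rewrite scalerDr; apply: btensDl.
- exact: btensDr.
- by rewrite scalerA mulrC -scalerA; apply: btens_bal.
Qed.

Lemma tens_ind M N (P : M ⊗ N -> Prop) :
    P 0 -> (forall t u, P t -> P u -> P (t + u)) -> (forall m n, P (m ⊗ n)) ->
  forall t, P t.
Proof.
move=> P0 PD Pp t; rewrite -(swd_btensor t).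
by apply: (big_ind P) => // p _; apply: Pp.
Qed.

Fact tscaleDr M N (a : k) : {morph @tscale M N a : t u / t + u}.
Proof. by move=> t u; apply: swdD; apply: tscale_bal. Qed.

Fact tscale_pure M N a (m : M) (n : N) : tscale a (m ⊗ n) = (a *: m) ⊗ n.
Proof. by rewrite [LHS]swdE //; apply: tscale_bal. Qed.

Fact tscale0 M N (a : k) : @tscale M N a 0 = 0.
Proof. by apply: (addIr (tscale a 0)); rewrite -tscaleDr !add0r. Qed.

Fact tscaleA M N (a b : k) (t : M ⊗ N) :
  tscale a (tscale b t) = tscale (a * b) t.
Proof.
elim/tens_ind: t => [|t u IHt IHu|m n]; first by rewrite !tscale0.
  by rewrite !tscaleDr IHt IHu.
by rewrite !tscale_pure scalerA.
Qed.

Fact tscale1 M N : left_id 1 (@tscale M N).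
Proof.
elim/tens_ind => [|t u IHt IHu|m n]; first by rewrite !tscale0.
  by rewrite !tscaleDr IHt IHu.
by rewrite !tscale_pure scale1r.
Qed.

Fact tscaleDl M N (t : M ⊗ N) : {morph (@tscale M N)^~ t : a b / a + b}.
Proof.
move=> a b; elim/tens_ind: t => [|t u IHt IHu|m n].
- by rewrite !tscale0 addr0.
- by rewrite !tscaleDr IHt IHu addrACA.
- by rewrite !tscale_pure scalerDl; apply: btensDl.
Qed.

HB.instance Definition _ M N := GRing.Zmodule_isLmodule.Build k (M ⊗ N)%type
  (@tscaleA M N) (@tscale1 M N) (@tscaleDr M N) (@tscaleDl M N).

Lemma tensDl M N (m m' : M) (n : N) : (m + m') ⊗ n = m ⊗ n + m' ⊗ n.
Proof. exact: btensDl. Qed.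

Lemma tensDr M N (m : M) (n n' : N) : m ⊗ (n + n') = m ⊗ n + m ⊗ n'.
Proof. exact: btensDr. Qed.

Lemma tensZl M N a (m : M) (n : N) : (a *: m) ⊗ n = a *: (m ⊗ n).
Proof. by rewrite -tscale_pure. Qed.

Lemma tensZr M N a (m : M) (n : N) : m ⊗ (a *: n) = a *: (m ⊗ n).
Proof. by rewrite -tensZl; apply/esym/btens_bal. Qed.

Lemma tensor_bilin M N : bilin (@tensor k M N).
Proof.
by split=> [m|n] a u v; rewrite ?tensDr ?tensZr ?tensDl ?tensZl.
Qed.

Lemma swd_pure M N V (f : M -> N -> V) m n :
  bilin f -> \swd_(x, y <- m ⊗ n) f x y = f m n.
Proof. by move=> /bilin_balanced; apply: swdE. Qed.

Lemma swd_lin M N V (f : M -> N -> V) :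
  bilin f -> linear (fun t : M ⊗ N => \swd_(x, y <- t) f x y).
Proof.
move=> fP a t u; have fB := bilin_balanced fP.
rewrite swdD //; congr (_ + _).
elim/tens_ind: t => [|t v IHt IHv|m n].
- have swd0 : swd (0 : M ⊗ N) f = 0.
    by apply: (addIr (swd (0 : M ⊗ N) f)); rewrite -swdD // !add0r.
  by rewrite scaler0 !swd0 scaler0.
- by rewrite scalerDr !swdD // IHt IHv scalerDr.
- by rewrite -tensZl !swd_pure //; case: fP => _ fl; rewrite (linZ (fl n)).
Qed.

Lemma swd_tensor M N (t : M ⊗ N) : \swd_(x, y <- t) x ⊗ y = t.
Proof. exact: swd_btensor. Qed.

End TensorTheory.

Section Linear.
Variable k : comPzRingType.
Implicit Types M N U V W : lmodType k.

Lemma lin_swd_body U M N V (t : M ⊗ N) (f : U -> M -> N -> V) :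
  (forall x y, linear (fun u => f u x y)) ->
  linear (fun u => \swd_(x, y <- t) f u x y).
Proof.
move=> fL a u v; rewrite /swd scaler_sumr -big_split /=.
by apply: eq_bigr => p _; apply: fL.
Qed.

Lemma lin_swd U M N V (t : U -> M ⊗ N) (f : M -> N -> V) :
  linear t -> bilin f -> linear (fun u => \swd_(x, y <- t u) f x y).
Proof. by move=> tL fP a u v; rewrite tL swd_lin. Qed.

Lemma eq_tens M N V (f g : M ⊗ N -> V) : linear f -> linear g ->
  (forall m n, f (m ⊗ n) = g (m ⊗ n)) -> f =1 g.
Proof.
move=> fL gL fg; elim/tens_ind => [|t u IHt IHu|m n] //.
  by rewrite !lin0.
by rewrite !linD // IHt IHu.
Qed.

End Linear.

Section TensorMaps.
Variable k : comPzRingType.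

Definition tmap (M N M' N' : lmodType k) (f : M -> M') (g : N -> N')
  (t : M ⊗ N) : M' ⊗ N' := \swd_(m, n <- t) f m ⊗ g n.

Definition tassoc (M N P : lmodType k) (t : M ⊗ N ⊗ P) : M ⊗ (N ⊗ P) :=
  \swd_(u, p <- t) \swd_(m, n <- u) m ⊗ (n ⊗ p).

End TensorMaps.

(* Associative unital k-algebras.  The library structure algType requires      *)
(* 1 != 0, which rules out the zero algebra; A ⊗ B may vanish for A, B != 0.   *)
Record assocAlg (k : comPzRingType) := AssocAlg {
  alg_mod : lmodType k;
  alg_one : alg_mod;
  alg_mul : alg_mod -> alg_mod -> alg_mod;
  alg_mulA : associative alg_mul;
  alg_mul1 : left_id alg_one alg_mul;
  alg_mulr1 : right_id alg_one alg_mul;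
  alg_mul_bilin : bilin alg_mul
}.

Definition alg_sort (k : comPzRingType) (A : assocAlg k) : Type := alg_mod A.
Coercion alg_sort : assocAlg >-> Sortclass.

Section AlgebraStructure.
Variables (k : comPzRingType) (A : assocAlg k).

HB.instance Definition _ := GRing.Lmodule.on (alg_sort A).

Fact alg_mulDl : left_distributive (@alg_mul k A) +%R.
Proof. by move=> x y z; rewrite (linD ((alg_mul_bilin A).2 z)). Qed.

Fact alg_mulDr : right_distributive (@alg_mul k A) +%R.
Proof. by move=> x y z; rewrite (linD ((alg_mul_bilin A).1 x)). Qed.

HB.instance Definition _ := GRing.Zmodule_isPzRing.Build (alg_sort A)
  (@alg_mulA k A) (@alg_mul1 k A) (@alg_mulr1 k A) alg_mulDl alg_mulDr.

Lemma alg_scalerAl (a : k) (x y : A) : a *: (x * y) = (a *: x) * y.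
Proof. by rewrite [RHS](linZ ((alg_mul_bilin A).2 y)). Qed.

Lemma alg_scalerAr (a : k) (x y : A) : a *: (x * y) = x * (a *: y).
Proof. by rewrite [RHS](linZ ((alg_mul_bilin A).1 x)). Qed.

Lemma mul_bilin : bilin (fun x y : A => x * y).
Proof. exact: alg_mul_bilin. Qed.

End AlgebraStructure.

Section TensorAlgebra.
Variables (k : comPzRingType) (A B : assocAlg k).

Definition tmul (s t : A ⊗ B) : A ⊗ B :=
  \swd_(a, b <- s) \swd_(a', b' <- t) (a * a') ⊗ (b * b').

Let mulL (C : assocAlg k) (x : C) : linear (fun y : C => x * y).
Proof. by move=> a u v; rewrite mulrDr -alg_scalerAr. Qed.

Let mulR (C : assocAlg k) (x : C) : linear (fun y : C => y * x).
Proof. by move=> a u v; rewrite mulrDl -alg_scalerAl. Qed.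

Fact tmul_bilin : bilin tmul.
Proof.
have bil (a : A) (b : B) :
    bilin (fun (a' : A) (b' : B) => (a * a') ⊗ (b * b')).
  split=> [x|y] c u v; first by rewrite mulL (tensor_bilin _ _).1.
  by rewrite mulL (tensor_bilin _ _).2.
have bil' (a' : A) (b' : B) : bilin (fun (a : A) (b : B) => (a * a') ⊗ (b * b')).
  split=> [x|y] c u v; first by rewrite mulR (tensor_bilin _ _).1.
  by rewrite mulR (tensor_bilin _ _).2.
split=> [s|t].
  by apply: lin_swd_body => x y; apply: swd_lin.
apply: swd_lin; split=> [x|y]; apply: lin_swd_body => u v;
  [exact: (bil' u v).1 | exact: (bil' u v).2].
Qed.

Lemma tmul_pure a b a' b' : tmul (a ⊗ b) (a' ⊗ b') = (a * a') ⊗ (b * b').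
Proof.
have bil (x : A) (y : B) :
    bilin (fun (x' : A) (y' : B) => (x * x') ⊗ (y * y')).
  split=> [z|z] c u v; first by rewrite mulL (tensor_bilin _ _).1.
  by rewrite mulL (tensor_bilin _ _).2.
rewrite /tmul swd_pure ?swd_pure //.
split=> [x|y]; apply: lin_swd_body => u v c p q.
  by rewrite mulR (tensor_bilin _ _).1.
by rewrite mulR (tensor_bilin _ _).2.
Qed.

Let tmulDl : left_distributive tmul +%R.
Proof. by move=> s t u; rewrite (linD (tmul_bilin.2 u)). Qed.

Let tmulDr : right_distributive tmul +%R.
Proof. by move=> s t u; rewrite (linD (tmul_bilin.1 s)). Qed.

Let tmul0l t : tmul 0 t = 0.
Proof. exact: (lin0 (tmul_bilin.2 t)). Qed.

Let tmul0r t : tmul t 0 = 0.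
Proof. exact: (lin0 (tmul_bilin.1 t)). Qed.

Let tmul1 : left_id ((1 : A) ⊗ (1 : B)) tmul.
Proof.
elim/tens_ind => [|t u IHt IHu|m n]; first by rewrite tmul0r.
  by rewrite tmulDr IHt IHu.
by rewrite tmul_pure !mul1r.
Qed.

Let tmulr1 : right_id ((1 : A) ⊗ (1 : B)) tmul.
Proof.
elim/tens_ind => [|t u IHt IHu|m n]; first by rewrite tmul0l.
  by rewrite tmulDl IHt IHu.
by rewrite tmul_pure !mulr1.
Qed.

Let tmulA : associative tmul.
Proof.
elim/tens_ind => [|s s' IHs IHs'|a b] t u; first by rewrite !tmul0l.
  by rewrite !tmulDl IHs IHs'.
elim/tens_ind: t => [|t t' IHt IHt'|a' b'].
- by rewrite !(tmul0l, tmul0r).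
- by rewrite !(tmulDl, tmulDr) IHt IHt'.
elim/tens_ind: u => [|u u' IHu IHu'|a'' b''].
- by rewrite !tmul0r.
- by rewrite !tmulDr IHu IHu'.
- by rewrite !tmul_pure !mulrA.
Qed.

HB.instance Definition _ := GRing.Zmodule_isPzRing.Build (A ⊗ B)%type
  tmulA tmul1 tmulr1 tmulDl tmulDr.

Lemma tens1E : 1 = (1 : A) ⊗ (1 : B) :> A ⊗ B. Proof. by []. Qed.

Lemma tensM a b a' b' : (a ⊗ b : A ⊗ B) * (a' ⊗ b') = (a * a') ⊗ (b * b').
Proof. exact: tmul_pure. Qed.

End TensorAlgebra.


Section Structures.
Variable k : comPzRingType.

Definition is_coalgebra (C : lmodType k) (D : {linear C -> (C ⊗ C)%type})
    (e : {scalar C}) : Prop :=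
  [/\ forall c, tassoc (tmap D id (D c)) = tmap id D (D c),
      forall c, \swd_(x, y <- D c) e x *: y = c
    & forall c, \swd_(x, y <- D c) e y *: x = c].

Record hopfAlg := HopfAlg {
  hopf_alg :> assocAlg k;
  comul : {linear hopf_alg -> (hopf_alg ⊗ hopf_alg)%type};
  counit : {scalar hopf_alg};
  antipode : {linear hopf_alg -> hopf_alg};
  hopf_coalg : is_coalgebra comul counit;
  comul_morph : monoid_morphism comul;
  counit_morph : monoid_morphism counit;
  antipodel : forall h, \swd_(x, y <- comul h) antipode x * y = counit h *: (1 : hopf_alg);
  antipoder : forall h, \swd_(x, y <- comul h) x * antipode y = counit h *: (1 : hopf_alg)
}.

Definition is_lcoaction (K : hopfAlg) (V : lmodType k)
    (rho : {linear V -> (K ⊗ V)%type}) : Prop :=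
  (forall v, tassoc (tmap (comul K) id (rho v)) = tmap id rho (rho v)) /\
  (forall v, \swd_(x, w <- rho v) counit K x *: w = v).

Definition is_rcoaction (H : hopfAlg) (V : lmodType k)
    (delta : {linear V -> (V ⊗ H)%type}) : Prop :=
  (forall v, tassoc (tmap delta id (delta v)) = tmap id (comul H) (delta v)) /\
  (forall v, \swd_(w, x <- delta v) counit H x *: w = v).

Record rcomodAlg (H : hopfAlg) := RcomodAlg {
  rcomod_alg :> assocAlg k;
  rcoact : {linear rcomod_alg -> (rcomod_alg ⊗ H)%type};
  rcoactP : is_rcoaction rcoact;
  rcoact_morph : monoid_morphism rcoact
}.

Record bicomodAlg (K H : hopfAlg) := BicomodAlg {
  bicomod_rcomod :> rcomodAlg H;
  lcoact : {linear bicomod_rcomod -> (K ⊗ bicomod_rcomod)%type};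
  lcoactP : is_lcoaction lcoact;
  lcoact_morph : monoid_morphism lcoact;
  bicoactP : forall a,
    tassoc (tmap lcoact id (rcoact bicomod_rcomod a))
    = tmap id (rcoact bicomod_rcomod) (lcoact a)
}.

End Structures.

Section HopfGalois.
Variables (k : comPzRingType) (H : hopfAlg k).

Definition coinv (A : rcomodAlg H) : {pred A} :=
  [pred b : A | rcoact A b == b ⊗ (1 : H)].

Arguments coinv : clear implicits.

Fact coinv_submod (A : rcomodAlg H) : submod_closed (coinv A).
Proof.
split=> [|a x y]; rewrite !inE.
  by rewrite linear0 (lin0 ((tensor_bilin _ _).2 _)).
by move=> /eqP xP /eqP yP; rewrite linearP xP yP (tensor_bilin _ _).2.
Qed.

HB.instance Definition _ (A : rcomodAlg H) :=
  GRing.isSubmodClosed.Build k A (coinv A) (coinv_submod A).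

Fact coinv_subring (A : rcomodAlg H) : subring_closed (coinv A).
Proof.
split=> [|x y xP yP|x y].
- by rewrite inE (rcoact_morph A).1.
- exact: rpredB.
- rewrite !inE (rcoact_morph A).2 => /eqP -> /eqP ->.
  by rewrite tensM mulr1.
Qed.

(* The subalgebra A^{coH}. *)
Record coinvType (A : rcomodAlg H) :=
  Coinv { coinv_val : A; coinv_valP : coinv_val \in coinv A }.

HB.instance Definition _ (A : rcomodAlg H) := [isSub for @coinv_val A].
HB.instance Definition _ (A : rcomodAlg H) := [Choice of coinvType A by <:].
HB.instance Definition _ (A : rcomodAlg H) :=
  [SubChoice_isSubLmodule of coinvType A by <:].

Variable A : rcomodAlg H.

(* A ⊗_B A, for B = A^{coH} acting on both sides by multiplication in A. *)
Definition tensB : Type :=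
  btens (fun (a : A) (b : coinvType A) => a * val b)
        (fun (b : coinvType A) (a : A) => val b * a).

HB.instance Definition _ := GRing.Zmodule.on tensB.

Definition can (t : tensB) : (A ⊗ H)%type :=
  \swd_(a, a' <- t) \swd_(a'0, a'1 <- rcoact A a') (a * a'0) ⊗ a'1.

Definition hopf_galois : Prop := bijective can.

End HopfGalois.

Arguments coinv {k H} A _.

Section Twist.
Variables (k : comPzRingType) (K : hopfAlg k).
Implicit Types s t : {scalar (K ⊗ K)%type}.

(* The value at g ⊗ h of the convolution product of s and t. *)
Definition conv2 s t (g h : K) : k :=
  \swd_(g1, g2 <- comul K g) \swd_(h1, h2 <- comul K h)
    (s (g1 ⊗ h1) * t (g2 ⊗ h2)).

Definition conv_invertible s : Prop :=
  exists t, forall g h, conv2 s t g h = counit K g * counit K h /\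
                        conv2 t s g h = counit K g * counit K h.

Record cocycle2 := Cocycle2 {
  cocycle_fun :> {scalar (K ⊗ K)%type};
  cocycle_inv : conv_invertible cocycle_fun;
  cocyclel1 : forall h : K, cocycle_fun (h ⊗ (1 : K)) = counit K h;
  cocycle1l : forall h : K, cocycle_fun ((1 : K) ⊗ h) = counit K h;
  cocycleA : forall g h l : K,
    \swd_(g1, g2 <- comul K g) \swd_(h1, h2 <- comul K h)
      (cocycle_fun (g1 ⊗ h1) * cocycle_fun ((g2 * h2) ⊗ l)) =
    \swd_(h1, h2 <- comul K h) \swd_(l1, l2 <- comul K l)
      (cocycle_fun (h1 ⊗ l1) * cocycle_fun (g ⊗ (h2 * l2)))
}.

End Twist.

Section SweedlerCalculus.
Variable k : comPzRingType.
Implicit Types M N P U V W : lmodType k.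

Definition trilin M N P V (f : M -> N -> P -> V) : Prop :=
  [/\ forall y z, linear (fun x => f x y z),
      forall x z, linear (fun y => f x y z)
    & forall x y, linear (f x y)].

Lemma eq_swd M N (V : zmodType) (t : M ⊗ N) (f g : M -> N -> V) :
  (forall x y, f x y = g x y) -> \swd_(x, y <- t) f x y = \swd_(x, y <- t) g x y.
Proof. by move=> fg; apply: eq_bigr. Qed.

Lemma swd_exchange M N P U (V : zmodType) (t : M ⊗ N) (u : P ⊗ U)
    (f : M -> N -> P -> U -> V) :
  \swd_(x, y <- t) \swd_(x', y' <- u) f x y x' y' =
  \swd_(x', y' <- u) \swd_(x, y <- t) f x y x' y'.
Proof. exact: exchange_big. Qed.

Lemma linear_swd M N V W (L : V -> W) (t : M ⊗ N) (f : M -> N -> V) :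
  linear L -> L (\swd_(x, y <- t) f x y) = \swd_(x, y <- t) L (f x y).
Proof.
by move=> LL; apply: (big_morph L); [exact: linD | exact: lin0].
Qed.

Lemma tmap_bilin M N M' N' (f : M -> M') (g : N -> N') :
  linear f -> linear g -> bilin (fun m n => f m ⊗ g n).
Proof.
move=> fL gL; split=> [m|n] a u v.
  by rewrite gL (tensor_bilin _ _).1.
by rewrite fL (tensor_bilin _ _).2.
Qed.

Lemma tmap_pure M N M' N' (f : M -> M') (g : N -> N') m n :
  linear f -> linear g -> tmap f g (m ⊗ n) = f m ⊗ g n.
Proof. by move=> fL gL; rewrite /tmap swd_pure //; apply: tmap_bilin. Qed.

Lemma tmap_lin M N M' N' (f : M -> M') (g : N -> N') :
  linear f -> linear g -> linear (tmap f g).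
Proof. by move=> fL gL; apply/swd_lin/tmap_bilin. Qed.

Lemma swd_tmap M N M' N' V (f : M -> M') (g : N -> N') (h : M' -> N' -> V) t :
  linear f -> linear g -> bilin h ->
  \swd_(x, y <- tmap f g t) h x y = \swd_(x, y <- t) h (f x) (g y).
Proof.
move=> fL gL hP; rewrite /tmap (linear_swd _ _ (swd_lin hP)).
by apply: eq_swd => x y; rewrite swd_pure.
Qed.

Lemma tassoc_bilin M N P : bilin (fun (u : M ⊗ N) (p : P) =>
  \swd_(m, n <- u) m ⊗ (n ⊗ p)).
Proof.
split=> [u|p].
  apply: lin_swd_body => m n a p q.
  by rewrite (tensor_bilin _ _).1 (tensor_bilin _ _).1.
apply: swd_lin; split=> [m|n] a u v.
  by rewrite (tensor_bilin _ _).2 (tensor_bilin _ _).1.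
by rewrite (tensor_bilin _ _).2.
Qed.

Lemma tassoc_pure M N P (m : M) (n : N) (p : P) :
  tassoc (m ⊗ n ⊗ p) = m ⊗ (n ⊗ p).
Proof.
rewrite /tassoc swd_pure ?swd_pure //; last exact: tassoc_bilin.
split=> [x|y] a u v.
  by rewrite (tensor_bilin _ _).2 (tensor_bilin _ _).1.
by rewrite (tensor_bilin _ _).2.
Qed.

Lemma trilinl M N P V (f : M -> N -> P -> V) : trilin f ->
  bilin (fun (u : M ⊗ N) (p : P) => \swd_(m, n <- u) f m n p).
Proof.
case=> f1 f2 f3; split=> [u|p]; first by apply: lin_swd_body => x y; apply: f3.
by apply: swd_lin; split=> [x|y]; [apply: f2 | apply: f1].
Qed.

Lemma trilinr M N P V (f : M -> N -> P -> V) : trilin f ->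
  bilin (fun (m : M) (u : N ⊗ P) => \swd_(n, p <- u) f m n p).
Proof.
case=> f1 f2 f3; split=> [m|u]; last by apply: lin_swd_body => x y; apply: f1.
by apply: swd_lin; split=> [x|y]; [apply: f3 | apply: f2].
Qed.

Lemma swd_tassoc M N P V (f : M -> N -> P -> V) (t : M ⊗ N ⊗ P) : trilin f ->
  \swd_(x, u <- tassoc t) \swd_(y, z <- u) f x y z =
  \swd_(u, z <- t) \swd_(x, y <- u) f x y z.
Proof.
move=> fP; rewrite /tassoc (linear_swd _ _ (swd_lin (trilinr fP))).
apply: eq_swd => u z; rewrite (linear_swd _ _ (swd_lin (trilinr fP))).
apply: eq_swd => x y; rewrite swd_pure ?swd_pure //; last exact: trilinr.
by case: fP => f1 f2 f3; split=> [a|b]; [apply: f3 | apply: f2].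
Qed.

Lemma tens_mulE (A B : assocAlg k) V (f : A -> B -> V) (s t : A ⊗ B) :
  bilin f -> \swd_(x, y <- s * t) f x y =
  \swd_(a, b <- s) \swd_(a', b' <- t) f (a * a') (b * b').
Proof.
move=> fP; rewrite [s * t]/(tmul s t) /tmul (linear_swd _ _ (swd_lin fP)).
apply: eq_swd => a b; rewrite (linear_swd _ _ (swd_lin fP)).
by apply: eq_swd => a' b'; rewrite swd_pure.
Qed.

Lemma lcoact_assoc (K : hopfAlg k) V W (rho : {linear V -> (K ⊗ V)%type})
    (f : K -> K -> V -> W) v : is_lcoaction rho -> trilin f ->
  \swd_(x, v0 <- rho v) \swd_(y, v00 <- rho v0) f x y v00 =
  \swd_(x, v0 <- rho v) \swd_(x1, x2 <- comul K x) f x1 x2 v0.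
Proof.
case=> rhoA _ fP.
transitivity (\swd_(x, u <- tmap id rho (rho v)) \swd_(y, z <- u) f x y z).
  by rewrite swd_tmap //; [exact: linearP | exact: trilinr].
rewrite -rhoA swd_tassoc // swd_tmap //; [exact: linearP | exact: trilinl].
Qed.

End SweedlerCalculus.

Section CanonicalMap.
Variables (k : comPzRingType) (H : hopfAlg k) (A : rcomodAlg H).

Lemma can_balanced : balanced
  (fun (a : A) (b : coinvType A) => a * val b)
  (fun (b : coinvType A) (a : A) => val b * a)
  (fun a a' : A => \swd_(a'0, a'1 <- rcoact A a') (a * a'0) ⊗ a'1).
Proof.
have bil (a : A) : bilin (fun (x : A) (h : H) => (a * x) ⊗ h).
  by apply: tmap_bilin => //; apply: (mul_bilin A).1.
split=> [a a' b|a b b'|a b a'].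
- rewrite /swd -big_split /=; apply: eq_bigr => p _.
  by rewrite mulrDl tensDl.
- by rewrite (linD (lin_swd _ (bil a))) //; apply: linearP.
- have /eqP bP := coinv_valP b.
  rewrite (rcoact_morph A).2 [rcoact A (val b)]bP tens_mulE // swd_pure.
    by apply: eq_swd => x y; rewrite mulrA mul1r.
  split=> [x|y]; apply: lin_swd_body => u v c p q.
    by rewrite (mul_bilin H).2 (tensor_bilin _ _).1.
  by rewrite (mul_bilin A).2 (bil a).2.
Qed.

(* The canonical map is a ⊗_B a' |-> a a'_(0) ⊗ a'_(1). *)
Lemma canE (a a' : A) :
  can (btensor _ _ a a' : tensB A) =
  \swd_(a'0, a'1 <- rcoact A a') (a * a'0) ⊗ a'1.
Proof. by rewrite /can swdE //; apply: can_balanced. Qed.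

Lemma canD (t u : tensB A) : can (t + u) = can t + can u.
Proof. by apply: swdD; apply: can_balanced. Qed.

End CanonicalMap.

Section TwistedAlgebra.
Variables (k : comPzRingType) (K H : hopfAlg k).
Variables (sigma : cocycle2 K) (A : bicomodAlg K H).

Definition twist_mul (a b : A) : A :=
  \swd_(x, a0 <- lcoact A a) \swd_(y, b0 <- lcoact A b)
    sigma (x ⊗ y) *: (a0 * b0).

Let sigl y : linear (fun x : K => sigma (x ⊗ y) : k^o).
Proof. by move=> a u v; rewrite tensDl tensZl linearP. Qed.

Let sigr x : linear (fun y : K => sigma (x ⊗ y) : k^o).
Proof. by move=> a u v; rewrite tensDr tensZr linearP. Qed.

Let sc (V : lmodType k) (M : lmodType k) (f : M -> k^o) (v : V) :
  linear f -> linear (fun x => (f x : k) *: v).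
Proof. by move=> fL a x y; rewrite fL scalerDl scalerA. Qed.

Let scr (V : lmodType k) (M : lmodType k) (c : k) (f : M -> V) :
  linear f -> linear (fun x => c *: f x).
Proof. by move=> fL a x y; rewrite fL scalerDr !scalerA mulrC. Qed.

Let mull (a : A) : linear (fun b : A => a * b). Proof. exact: (mul_bilin A).1. Qed.
Let mulr (b : A) : linear (fun a : A => a * b). Proof. exact: (mul_bilin A).2. Qed.

Let coL : linear (lcoact A). Proof. exact: linearP. Qed.

Fact twist_bilin : bilin twist_mul.
Proof.
split=> [a|b].
  apply: lin_swd_body => x a0; apply: lin_swd => //.
  by split=> [y|b0]; [apply: scr | apply: sc].
apply: lin_swd => //; split=> [x|a0]; apply: lin_swd_body => y b0.
  exact: scr.
exact: sc.
Qed.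


Let sigMl (y z : K) : linear (fun x : K => sigma ((x * y) ⊗ z) : k^o).
Proof. by move=> a u v; rewrite (mul_bilin K).2 sigl. Qed.

Let sigMr (y z : K) : linear (fun x : K => sigma ((y * x) ⊗ z) : k^o).
Proof. by move=> a u v; rewrite (mul_bilin K).1 sigl. Qed.

Let sigrMl (y z : K) : linear (fun x : K => sigma (z ⊗ (x * y)) : k^o).
Proof. by move=> a u v; rewrite (mul_bilin K).2 sigr. Qed.

Let sigrMr (y z : K) : linear (fun x : K => sigma (z ⊗ (y * x)) : k^o).
Proof. by move=> a u v; rewrite (mul_bilin K).1 sigr. Qed.

Fact twist_mul1 : left_id (1 : A) twist_mul.
Proof.
move=> b; rewrite /twist_mul (lcoact_morph A).1 swd_pure; last first.
  split=> [x|a0]; apply: lin_swd_body => y b0; last exact: sc.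
  by apply: scr.
rewrite -[RHS]((lcoactP A).2 b); apply: eq_swd => y b0.
by rewrite cocycle1l mul1r.
Qed.

Fact twist_mulr1 : right_id (1 : A) twist_mul.
Proof.
move=> a; rewrite /twist_mul (lcoact_morph A).1.
rewrite -[RHS]((lcoactP A).2 a); apply: eq_swd => x a0.
rewrite swd_pure; last by split=> [y|b0]; [apply: scr | apply: sc].
by rewrite cocyclel1 mulr1.
Qed.

Let twist_mulAl a b c : twist_mul (twist_mul a b) c =
  \swd_(x, a0 <- lcoact A a) \swd_(y, b0 <- lcoact A b)
  \swd_(z, c0 <- lcoact A c)
    (\swd_(x1, x2 <- comul K x) \swd_(y1, y2 <- comul K y)
       (sigma (x1 ⊗ y1) * sigma ((x2 * y2) ⊗ z))) *: (a0 * b0 * c0).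
Proof.
have tL : linear (twist_mul^~ c) by exact: twist_bilin.2.
rewrite {2}/twist_mul (linear_swd _ _ tL).
transitivity (\swd_(x, a0 <- lcoact A a) \swd_(x', a00 <- lcoact A a0)
  \swd_(y, b0 <- lcoact A b) \swd_(y', b00 <- lcoact A b0)
  \swd_(z, c0 <- lcoact A c)
    sigma (x ⊗ y) *: (sigma ((x' * y') ⊗ z) *: (a00 * b00 * c0))).
  apply: eq_swd => x a0; rewrite (linear_swd _ _ tL) [RHS]swd_exchange.
  apply: eq_swd => y b0; rewrite (linZ tL) /twist_mul (lcoact_morph A).2.
  rewrite tens_mulE; last first.
    by split=> [u|v]; apply: lin_swd_body => z c0; [apply: scr | apply: sc].
  have sL : linear (fun v : A => sigma (x ⊗ y) *: v) by apply: scr.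
  rewrite (linear_swd _ _ sL); apply: eq_swd => x' a00.
  rewrite (linear_swd _ _ sL); apply: eq_swd => y' b00.
  exact: linear_swd.
rewrite lcoact_assoc; [|exact: lcoactP|]; last first.
  split=> u v; do 3![apply: lin_swd_body => ? ?].
  - exact: sc.
  - by apply: scr; apply: sc.
  - by do 2!apply: scr; move=> r p q; rewrite mulr mulr.
apply: eq_swd => x a0.
under eq_swd => x1 x2.
  rewrite lcoact_assoc; [|exact: lcoactP|]; last first.
    split=> u v; apply: lin_swd_body => ? ?.
    - exact: sc.
    - by apply: scr; apply: sc.
    - by do 2!apply: scr; move=> r p q; rewrite mull mulr.
  over.
rewrite swd_exchange; apply: eq_swd => y b0.
under eq_swd => x1 x2 do rewrite swd_exchange.
rewrite swd_exchange; apply: eq_swd => z c0.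
rewrite [in RHS]/swd scaler_suml; apply: eq_bigr => p _.
rewrite scaler_suml; apply: eq_bigr => q _.
by rewrite scalerA.
Qed.

Let twist_mulAr a b c : twist_mul a (twist_mul b c) =
  \swd_(x, a0 <- lcoact A a) \swd_(y, b0 <- lcoact A b)
  \swd_(z, c0 <- lcoact A c)
    (\swd_(y1, y2 <- comul K y) \swd_(z1, z2 <- comul K z)
       (sigma (y1 ⊗ z1) * sigma (x ⊗ (y2 * z2)))) *: (a0 * b0 * c0).
Proof.
have tL : linear (twist_mul a) by exact: twist_bilin.1.
rewrite {2}/twist_mul (linear_swd _ _ tL).
transitivity (\swd_(x, a0 <- lcoact A a)
  \swd_(y, b0 <- lcoact A b) \swd_(y', b00 <- lcoact A b0)
  \swd_(z, c0 <- lcoact A c) \swd_(z', c00 <- lcoact A c0)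
    sigma (y ⊗ z) *: (sigma (x ⊗ (y' * z')) *: (a0 * b00 * c00))).
  rewrite [RHS]swd_exchange; apply: eq_swd => y b0.
  rewrite (linear_swd _ _ tL).
  under [RHS]eq_swd => x a0 do rewrite swd_exchange.
  rewrite [RHS]swd_exchange; apply: eq_swd => z c0.
  rewrite (linZ tL) /twist_mul (lcoact_morph A).2.
  have sL : linear (fun v : A => sigma (y ⊗ z) *: v) by apply: scr.
  rewrite (linear_swd _ _ sL); apply: eq_swd => x a0.
  rewrite tens_mulE; last by split=> [u|v]; [apply: scr | apply: sc].
  rewrite (linear_swd _ _ sL); apply: eq_swd => y' b00.
  rewrite (linear_swd _ _ sL); apply: eq_swd => z' c00.
  by rewrite mulrA.
apply: eq_swd => x a0; rewrite lcoact_assoc; [|exact: lcoactP|]; last first.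
  split=> u v; do 2![apply: lin_swd_body => ? ?].
  - exact: sc.
  - by apply: scr; apply: sc.
  - by do 2!apply: scr; move=> r p q; rewrite mull mulr.
apply: eq_swd => y b0.
under eq_swd => y1 y2.
  rewrite lcoact_assoc; [|exact: lcoactP|]; last first.
    split=> u v.
    - exact: sc.
    - by apply: scr; apply: sc.
    - by do 2!apply: scr.
  over.
rewrite swd_exchange; apply: eq_swd => z c0.
rewrite [in RHS]/swd scaler_suml; apply: eq_bigr => p _.
rewrite scaler_suml; apply: eq_bigr => q _.
by rewrite scalerA.
Qed.

Fact twist_mulA : associative twist_mul.
Proof.
move=> a b c; rewrite twist_mulAl twist_mulAr.
apply: eq_swd => x a0; apply: eq_swd => y b0; apply: eq_swd => z c0.
by rewrite cocycleA.
Qed.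

Definition twist_alg : assocAlg k :=
  AssocAlg twist_mulA twist_mul1 twist_mulr1 twist_bilin.


Let rcL : linear (rcoact A). Proof. exact: linearP. Qed.

Let bico_swd (W : lmodType k) (f : K -> A -> H -> W) a : trilin f ->
  \swd_(a0, a1 <- rcoact A a) \swd_(x, a00 <- lcoact A a0) f x a00 a1 =
  \swd_(x, a0 <- lcoact A a) \swd_(a00, a1 <- rcoact A a0) f x a00 a1.
Proof.
move=> fP.
transitivity (\swd_(u, a1 <- tmap (lcoact A) id (rcoact A a))
    \swd_(x, a00 <- u) f x a00 a1).
  by rewrite swd_tmap //; exact: trilinl.
rewrite -swd_tassoc // bicoactP swd_tmap //; exact: trilinr.
Qed.

Let rcoact_twist_mul a b : rcoact A (twist_mul a b) =
  \swd_(a0, a1 <- rcoact A a) \swd_(b0, b1 <- rcoact A b)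
    twist_mul a0 b0 ⊗ (a1 * b1).
Proof.
have tL (h : H) : linear (fun u : A => u ⊗ h) by exact: (tensor_bilin A H).2.
have tR (u : A) : linear (fun h : H => u ⊗ h) by exact: (tensor_bilin A H).1.
have AL (c d : A) (h : H) : linear (fun u : A => (u * c) ⊗ h).
  by move=> r p q; rewrite mulr tL.
have AR (c d : A) (h : H) : linear (fun u : A => (c * u) ⊗ h).
  by move=> r p q; rewrite mull tL.
have HL (c : A) (h : H) : linear (fun u : H => c ⊗ (u * h)).
  by move=> r p q; rewrite (mul_bilin H).2 tR.
have HR (c : A) (h : H) : linear (fun u : H => c ⊗ (h * u)).
  by move=> r p q; rewrite (mul_bilin H).1 tR.
rewrite {1}/twist_mul (linear_swd _ _ rcL).
transitivity (\swd_(x, a0 <- lcoact A a) \swd_(a00, a1 <- rcoact A a0)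
    \swd_(y, b0 <- lcoact A b) \swd_(b00, b1 <- rcoact A b0)
    sigma (x ⊗ y) *: ((a00 * b00) ⊗ (a1 * b1))).
  apply: eq_swd => x a0; rewrite (linear_swd _ _ rcL) [RHS]swd_exchange.
  apply: eq_swd => y b0; rewrite (linZ rcL) (rcoact_morph A).2.
  have sL : linear (fun v : (A ⊗ H)%type => sigma (x ⊗ y) *: v) by apply: scr.
  rewrite -[_ * _]swd_tensor tens_mulE; last exact: tensor_bilin.
  rewrite (linear_swd _ _ sL); apply: eq_swd => a00 a1.
  by rewrite (linear_swd _ _ sL).
rewrite -bico_swd; last first.
  split=> u v; do 2![apply: lin_swd_body => ? ?].
  - exact: sc.
  - by apply: scr; apply: AL.
  - by apply: scr; apply: HL.
apply: eq_swd => a0 a1.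
transitivity (\swd_(x, a00 <- lcoact A a0) \swd_(b0, b1 <- rcoact A b)
    \swd_(y, b00 <- lcoact A b0)
    sigma (x ⊗ y) *: ((a00 * b00) ⊗ (a1 * b1))).
  apply: eq_swd => x a00; rewrite -bico_swd //.
  split=> u v; [exact: sc| |]; apply: scr; [exact: AR | exact: HR].
rewrite swd_exchange; apply: eq_swd => b0 b1.
rewrite /twist_mul (linear_swd _ _ (tL _)); apply: eq_swd => x a00.
rewrite (linear_swd _ _ (tL _)); apply: eq_swd => y b00.
by rewrite tensZl.
Qed.

Definition twist_rcoact : {linear twist_alg -> (twist_alg ⊗ H)%type} := rcoact A.

Fact twist_rcoactP : is_rcoaction twist_rcoact.
Proof. exact: (rcoactP A). Qed.

Fact twist_rcoact_morph : monoid_morphism twist_rcoact.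
Proof.
split; first exact: (rcoact_morph A).1.
move=> a b; rewrite -[RHS]swd_tensor tens_mulE; last exact: tensor_bilin.
exact: rcoact_twist_mul.
Qed.

(* The right H-comodule algebra with product                                   *)
(* sigma (a_(-1) ⊗ a'_(-1)) a_(0) a'_(0) on the module A.                      *)
Definition twist : rcomodAlg H := RcomodAlg twist_rcoactP twist_rcoact_morph.

End TwistedAlgebra.

Section Subcomodule.
Variables (k : comPzRingType) (K H : hopfAlg k) (A : bicomodAlg K H).

(* K ⊗ B -> K ⊗ A need not be injective, so the restriction of the coaction to *)
(* B = A^{coH} is required to be itself a coaction.                            *)
Definition coinv_subcomodule : Prop :=
  exists rhoB : {linear coinvType A -> (K ⊗ coinvType A)%type},
    is_lcoaction rhoB /\
    forall b, tmap id val (rhoB b) = lcoact A (val b).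

End Subcomodule.

(* Main.v *)
Require Import Defs.
From HB Require Import structures.
From mathcomp Require Import all_boot all_algebra.
From mathcomp Require Import boolp.

Set Implicit Arguments.
Unset Strict Implicit.
Unset Printing Implicit Defensive.

Import GRing.Theory.
Local Open Scope ring_scope.

(** A linear form s on K ⊗ K acts on V ⊗ W, for left K-comodules V and W, by
    v ⊗ w |-> s (v_(-1) ⊗ w_(-1)) v_(0) ⊗ w_(0).  Composition of these actions
    is convolution of forms (tens_actK), so a 2-cocycle sigma acts bijectively,
    its convolution inverse tau giving the inverse.  The action is natural in
    colinear maps (tens_act_natural), and the cocycle identity says that it is
    coherent with reassociation (tens_act_cocycle): the actions
    of sigma form a monoidal structure on the forgetful functor from
    K-comodules to modules.

    The twisted product is the product of A precomposed with the action of
    sigma.  Write B for the coinvariants, Bs and As for the twisted algebras.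
    The action of sigma on A ⊗ A carries the relations a • b ⊗ a' = a ⊗ b • a'
    that define As ⊗_Bs As to the relations a b ⊗ a' = a ⊗ b a' that define
    A ⊗_B A, for this reason.  Both families are parametrized by A ⊗ B ⊗ A;
    by naturality and coherence, the action of sigma on A ⊗ A intertwines them up
    to one and the same map omega of A ⊗ B ⊗ A.  Since omega is a composite of
    two actions of sigma it is invertible, so that the relations correspond
    exactly and As ⊗_Bs As is in bijection with A ⊗_B A (proj_sigma and
    proj_tau).  Here B has to be a K-comodule for sigma to act on A ⊗ B.

    Since the two coactions on A commute, the canonical map of As is that of A
    after this bijection (can_projT).  Hence one is bijective if and only if
    the other is. *)

(** * Linearity of Sweedler expressions *)

Section LinearForms.
Variable k : comPzRingType.
Implicit Types M N P V W : lmodType k.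

Lemma lin_id M : linear (fun x : M => x). Proof. by []. Qed.

Lemma lin_comp M V W (L : V -> W) (f : M -> V) :
  linear L -> linear f -> linear (fun x => L (f x)).
Proof. by move=> LL fL a x y; rewrite fL LL. Qed.

Lemma lin_linear M V W (L : {linear V -> W}) (f : M -> V) :
  linear f -> linear (fun x => L (f x)).
Proof. by move=> fL a x y; rewrite fL linearP. Qed.

Lemma lin_tensl M V W (f : M -> V) (w : W) :
  linear f -> linear (fun x => f x ⊗ w).
Proof. by move=> fL a x y; rewrite fL tensDl tensZl. Qed.

Lemma lin_tensr M V W (f : M -> W) (v : V) :
  linear f -> linear (fun x => v ⊗ f x).
Proof. by move=> fL a x y; rewrite fL tensDr tensZr. Qed.

Lemma lin_scaler M V (f : M -> V) (c : k) :
  linear f -> linear (fun x => c *: f x).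
Proof. by move=> fL a x y; rewrite fL scalerDr !scalerA mulrC. Qed.

Lemma lin_scalel M V W (s : {scalar W}) (f : M -> W) (v : V) :
  linear f -> linear (fun x => s (f x) *: v).
Proof. by move=> fL a x y; rewrite fL linearP scalerDl scalerA. Qed.

Lemma lin_mull M (A : assocAlg k) (f : M -> A) (b : A) :
  linear f -> linear (fun x => f x * b).
Proof. by move=> fL a x y; rewrite fL (mul_bilin A).2. Qed.

Lemma lin_mulr M (A : assocAlg k) (f : M -> A) (b : A) :
  linear f -> linear (fun x => b * f x).
Proof. by move=> fL a x y; rewrite fL (mul_bilin A).1. Qed.

Lemma tassoc_lin M N P : linear (@tassoc k M N P).
Proof. exact/swd_lin/tassoc_bilin. Qed.

Lemma tmap_cancel_l M N P (f : M -> N) (g : N -> M) :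
  linear f -> linear g -> cancel f g -> cancel (tmap f (@id P)) (tmap g id).
Proof.
move=> fL gL fK; apply: eq_tens => [| |m p]; [|exact: lin_id|].
  exact: lin_comp (tmap_lin gL (@lin_id P)) (tmap_lin fL (@lin_id P)).
by rewrite !tmap_pure // fK.
Qed.

End LinearForms.

(** Proves that an expression built from Sweedler sums, tensors, products and
    linear maps is linear in a variable, in two variables or in three.  The
    bilinear operations reappear in the last branch because unification
    eta-contracts a function such as fun y => x ⊗ y to a partial
    application. *)
Ltac lin := intros; cbv beta; lazymatch goal with
  | |- bilin _ => split; lin
  | |- trilin _ => split; lin
  | |- linear (fun x => x) => exact: lin_id
  | |- linear (fun x => swd (@?t x) (fun m n => @?f x m n)) =>
     lazymatch t with
     | (fun _ => ?t0) => apply: lin_swd_body; lin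
     | _ => apply: lin_swd; lin
     end
  | |- linear (fun x => _ ⊗ _) =>
       first [apply: lin_tensl; lin | apply: lin_tensr; lin]
  | |- linear (fun x => _ *: _) =>
       first [apply: lin_scalel; lin | apply: lin_scaler; lin]
  | |- linear (fun x => _ * _) =>
       first [apply: lin_mull; lin | apply: lin_mulr; lin]
  | _ => first [done | assumption | exact: (tensor_bilin _ _).1
      | exact: (mul_bilin _).1 | exact: linearP | apply: lin_linear; lin]
  end.

(** * Linear forms on K ⊗ K acting on tensor products of comodules *)

Section Comodules.
Variables (k : comPzRingType) (K : hopfAlg k).

Record lcomod := LComod {
  lcomod_mod :> lmodType k;
  lcomod_coact : {linear lcomod_mod -> (K ⊗ lcomod_mod)%type};
  lcomod_coactP : is_lcoaction lcomod_coact
}.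

Implicit Types (V W U : lcomod) (s : {scalar (K ⊗ K)%type}).

(** Coassociativity in both factors at once, with the Sweedler legs already in
    the interleaved order in which two successive actions on V ⊗ W, and the
    diagonal coaction, produce them. *)
Lemma coact2_assoc V W (X : lmodType k)
    (F : K -> K -> K -> K -> V -> W -> X) v w :
    (forall y x' y' v w, linear (fun x => F x y x' y' v w)) ->
    (forall x x' y' v w, linear (fun y => F x y x' y' v w)) ->
    (forall x y y' v w, linear (fun x' => F x y x' y' v w)) ->
    (forall x y x' v w, linear (fun y' => F x y x' y' v w)) ->
    (forall x y x' y' w, linear (fun v => F x y x' y' v w)) ->
    (forall x y x' y' v, linear (fun w => F x y x' y' v w)) ->
  \swd_(x, v0 <- lcomod_coact V v) \swd_(y, w0 <- lcomod_coact W w)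
  \swd_(x', v00 <- lcomod_coact V v0) \swd_(y', w00 <- lcomod_coact W w0)
    F x y x' y' v00 w00 =
  \swd_(x, v0 <- lcomod_coact V v) \swd_(y, w0 <- lcomod_coact W w)
  \swd_(x1, x2 <- comul K x) \swd_(y1, y2 <- comul K y)
    F x1 y1 x2 y2 v0 w0.
Proof.
move=> F1 F2 F3 F4 F5 F6.
under eq_swd => x v0 do rewrite swd_exchange.
rewrite lcoact_assoc; [|exact: lcomod_coactP|]; last first.
  split=> *; do 2![apply: lin_swd_body => ? ?]; do ?[by []].
apply: eq_swd => x v0.
rewrite [RHS]swd_exchange; apply: eq_swd => x1 x2.
rewrite lcoact_assoc //; exact: lcomod_coactP.
Qed.

Definition tens_act V W s (t : V ⊗ W) : (V ⊗ W)%type :=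
  \swd_(v, w <- t)
  \swd_(x, v0 <- lcomod_coact V v) \swd_(y, w0 <- lcomod_coact W w)
    s (x ⊗ y) *: (v0 ⊗ w0).

Lemma tens_act_bilin V W s : bilin (fun (v : V) (w : W) =>
  \swd_(x, v0 <- lcomod_coact V v) \swd_(y, w0 <- lcomod_coact W w)
    s (x ⊗ y) *: (v0 ⊗ w0)).
Proof. lin. Qed.

Lemma tens_act_lin V W s : linear (@tens_act V W s).
Proof. exact/swd_lin/tens_act_bilin. Qed.

Lemma tens_act_pure V W s (v : V) (w : W) : tens_act s (v ⊗ w) =
  \swd_(x, v0 <- lcomod_coact V v) \swd_(y, w0 <- lcomod_coact W w)
    s (x ⊗ y) *: (v0 ⊗ w0).
Proof. exact/swd_pure/tens_act_bilin. Qed.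

(** By coassociativity, acting by t and then by s is acting by the convolution
    product of t and s; the convolution unit acts trivially by counitality. *)
Lemma tens_actK V W s t :
    (forall g h, conv2 t s g h = counit K g * counit K h) ->
  cancel (@tens_act V W t) (tens_act s).
Proof.
move=> tsE; apply: eq_tens => [| |v w]; [|exact: lin_id|].
  by apply: lin_comp; apply: tens_act_lin.
rewrite tens_act_pure (linear_swd _ _ (@tens_act_lin _ _ s)).
transitivity (\swd_(x, v0 <- lcomod_coact V v) \swd_(y, w0 <- lcomod_coact W w)
  \swd_(x', v00 <- lcomod_coact V v0) \swd_(y', w00 <- lcomod_coact W w0)
    t (x ⊗ y) *: (s (x' ⊗ y') *: (v00 ⊗ w00))).
  apply: eq_swd => x v0; rewrite (linear_swd _ _ (@tens_act_lin _ _ s)).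
  apply: eq_swd => y w0; rewrite (linZ (@tens_act_lin _ _ s)) tens_act_pure.
  rewrite linear_swd; last lin.
  by apply: eq_swd => x' v00; rewrite linear_swd; last lin.
rewrite (@coact2_assoc _ _ _ (fun x y x' y' v w =>
  t (x ⊗ y) *: (s (x' ⊗ y') *: (v ⊗ w)))); try lin.
transitivity (\swd_(x, v0 <- lcomod_coact V v) \swd_(y, w0 <- lcomod_coact W w)
  ((counit K x *: v0) ⊗ (counit K y *: w0))).
  apply: eq_swd => x v0; apply: eq_swd => y w0.
  rewrite tensZl tensZr scalerA -tsE.
  rewrite [in RHS]/conv2 [in RHS]/swd scaler_suml; apply: eq_bigr => p _.
  rewrite scaler_suml; apply: eq_bigr => q _.
  by rewrite scalerA.
rewrite -{2}((lcomod_coactP V).2 v) -{2}((lcomod_coactP W).2 w).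
rewrite [RHS](linear_swd (L := fun u => u ⊗ _)); last lin.
apply: eq_swd => x v0; rewrite [RHS](linear_swd (L := fun u => _ ⊗ u)) //; lin.
Qed.

Definition diag_coact_fun V W (t : V ⊗ W) : (K ⊗ (V ⊗ W))%type :=
  \swd_(v, w <- t)
  \swd_(x, v0 <- lcomod_coact V v) \swd_(y, w0 <- lcomod_coact W w)
    (x * y) ⊗ (v0 ⊗ w0).

Lemma diag_bilin V W : bilin (fun (v : V) (w : W) =>
  \swd_(x, v0 <- lcomod_coact V v) \swd_(y, w0 <- lcomod_coact W w)
    (x * y) ⊗ (v0 ⊗ w0)).
Proof. lin. Qed.

Lemma diag_coact_fun_lin V W : linear (@diag_coact_fun V W).
Proof. exact/swd_lin/diag_bilin. Qed.

HB.instance Definition _ V W := GRing.isLinear.Build k (V ⊗ W)%type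
  (K ⊗ (V ⊗ W))%type *:%R (@diag_coact_fun V W) (@diag_coact_fun_lin V W).

Definition diag_coact V W : {linear (V ⊗ W)%type -> (K ⊗ (V ⊗ W))%type} :=
  @diag_coact_fun V W.
Arguments diag_coact : simpl never.

Lemma diag_coact_pure V W (v : V) (w : W) : diag_coact V W (v ⊗ w) =
  \swd_(x, v0 <- lcomod_coact V v) \swd_(y, w0 <- lcomod_coact W w)
    (x * y) ⊗ (v0 ⊗ w0).
Proof. exact/swd_pure/diag_bilin. Qed.

(** Coassociativity and counitality hold because the comultiplication and the
    counit of K are multiplicative. *)
Lemma diag_coactP V W : is_lcoaction (diag_coact V W).
Proof.
have DL : linear (tmap (comul K) (@id (V ⊗ W)%type)) by apply: tmap_lin; lin.
have RL : linear (tmap (@id K) (diag_coact V W)) by apply: tmap_lin; lin.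
split.
  have aDL := lin_comp (@tassoc_lin k K K (V ⊗ W)%type) DL.
  apply: eq_tens => [| |v w];
    [by apply: (lin_comp aDL); lin | by apply: (lin_comp RL); lin|].
  rewrite diag_coact_pure (linear_swd _ _ aDL) (linear_swd _ _ RL).
  transitivity (\swd_(x, v0 <- lcomod_coact V v)
    \swd_(y, w0 <- lcomod_coact W w)
    \swd_(x', v00 <- lcomod_coact V v0) \swd_(y', w00 <- lcomod_coact W w0)
      (x * y) ⊗ ((x' * y') ⊗ (v00 ⊗ w00))); last first.
    apply: eq_swd => x v0; rewrite (linear_swd _ _ RL).
    apply: eq_swd => y w0; rewrite tmap_pure; [|lin|lin].
    rewrite diag_coact_pure linear_swd; last lin.
    by apply: eq_swd => x' v00; rewrite linear_swd; last lin.
  rewrite (@coact2_assoc _ _ _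
    (fun x y x' y' v w => (x * y) ⊗ ((x' * y') ⊗ (v ⊗ w)))); try lin.
  apply: eq_swd => x v0; rewrite (linear_swd _ _ aDL).
  apply: eq_swd => y w0; rewrite tmap_pure; [|lin|lin].
  rewrite (comul_morph K).2 -[_ * _]swd_tensor tens_mulE; last lin.
  have tL : linear (fun t : (K ⊗ K)%type => tassoc (t ⊗ (v0 ⊗ w0))).
    by apply: lin_comp; [exact: tassoc_lin | lin].
  rewrite (linear_swd _ _ tL); apply: eq_swd => x1 x2.
  by rewrite (linear_swd _ _ tL); apply: eq_swd => y1 y2; rewrite tassoc_pure.
have eL : bilin (fun (x : K) (t : (V ⊗ W)%type) => counit K x *: t).
  by split=> [x|t]; [lin | move=> a u v; rewrite linearP scalerDl scalerA].
have cL := swd_lin eL.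
apply: eq_tens => [| |v w]; [by apply: (lin_comp cL); lin|lin|].
rewrite diag_coact_pure (linear_swd _ _ cL).
rewrite -{2}((lcomod_coactP V).2 v) -{2}((lcomod_coactP W).2 w).
rewrite [RHS](linear_swd (L := fun u => u ⊗ _)); last lin.
apply: eq_swd => x v0; rewrite (linear_swd _ _ cL).
rewrite [RHS](linear_swd (L := fun u => _ ⊗ u)); last lin.
apply: eq_swd => y w0.
by rewrite swd_pure // (counit_morph K).2 tensZl tensZr scalerA.
Qed.

(** The tensor product of comodules, with the diagonal coaction
    v ⊗ w |-> v_(-1) w_(-1) ⊗ (v_(0) ⊗ w_(0)). *)
Definition lctens V W : lcomod := LComod (@diag_coactP V W).

Definition colinear V V' (g : V -> V') : Prop := linear g /\
  forall v, lcomod_coact V' (g v) = tmap id g (lcomod_coact V v).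

Lemma colinear_id V : colinear (@id V).
Proof. by split=> [|v]; [lin | rewrite /tmap swd_tensor]. Qed.

Lemma colinear_comp U V W (g : V -> W) (h : U -> V) :
  colinear g -> colinear h -> colinear (g \o h).
Proof.
case=> gL gC [hL hC]; split=> [|v]; first exact: lin_comp gL hL.
by rewrite /= gC hC [LHS]swd_tmap //; lin.
Qed.

Lemma colinear_tmap V V' W W' (g : V -> V') (h : W -> W') :
  colinear g -> colinear h ->
  @colinear (lctens V W) (lctens V' W') (tmap g h).
Proof.
case=> gL gC [hL hC]; have tL := tmap_lin gL hL; split=> //=.
have ttL : linear (tmap (@id K) (tmap g h)) by apply: tmap_lin; lin.
apply: eq_tens => [| |v w]; [exact: lin_comp (linearP _) tL| |].
  exact: lin_comp ttL (linearP _).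
rewrite tmap_pure // !diag_coact_pure gC (linear_swd _ _ ttL) swd_tmap //;
  try lin.
apply: eq_swd => x v0; rewrite hC (linear_swd _ _ ttL) swd_tmap //; try lin.
by apply: eq_swd => y w0; rewrite !tmap_pure.
Qed.

Lemma tens_act_natural V V' W W' s (g : V -> V') (h : W -> W') t :
  colinear g -> colinear h -> tens_act s (tmap g h t) = tmap g h (tens_act s t).
Proof.
case=> gL gC [hL hC]; have tL := tmap_lin gL hL.
have aL V0 W0 := @tens_act_lin V0 W0 s.
move: t; apply: eq_tens => [| |v w];
  [exact: lin_comp (aL _ _) tL | exact: lin_comp tL (aL _ _) |].
rewrite tmap_pure // !tens_act_pure gC (linear_swd _ _ tL) swd_tmap //; try lin.
apply: eq_swd => x v0; rewrite hC (linear_swd _ _ tL) swd_tmap //; try lin.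
by apply: eq_swd => y w0; rewrite (linZ tL) tmap_pure.
Qed.

(** On v ⊗ w ⊗ u both sides have the form
    c (v_(-1), w_(-1), u_(-1)) v_(0) ⊗ (w_(0) ⊗ u_(0)), where c is the left
    hand side of the cocycle identity for one and its right hand side for the
    other. *)
Lemma tens_act_cocycle V W U (sigma : cocycle2 K) (t : V ⊗ W ⊗ U) :
  tassoc (@tens_act (lctens V W) U sigma (tmap (tens_act sigma) id t)) =
  @tens_act V (lctens W U) sigma (tmap id (tens_act sigma) (tassoc t)).
Proof.
have aL V0 W0 := @tens_act_lin V0 W0 sigma.
have asL := @tassoc_lin k V W U.
have saL := lin_comp asL (aL (lctens V W) U).
have tlL : linear (tmap (@tens_act V W sigma) (@id U)).
  exact: tmap_lin (aL V W) (@lin_id _ U).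
have trL : linear (tmap (@id V) (@tens_act W U sigma)).
  exact: tmap_lin (@lin_id _ V) (aL W U).
move: t; apply: eq_tens => [| |t u]; [exact: lin_comp saL tlL| |].
  exact: lin_comp (aL V (lctens W U)) (lin_comp trL asL).
move: t; apply: eq_tens => [| |v w].
- exact: lin_comp (lin_comp saL tlL) ((tensor_bilin _ _).2 u).
- exact: lin_comp (lin_comp (aL V (lctens W U)) (lin_comp trL asL))
    ((tensor_bilin _ _).2 u).
rewrite tassoc_pure !tmap_pure //; [|exact: aL|exact: aL].
transitivity (\swd_(x, v0 <- lcomod_coact V v) \swd_(y, w0 <- lcomod_coact W w)
  \swd_(z, u0 <- lcomod_coact U u)
    (\swd_(x1, x2 <- comul K x) \swd_(y1, y2 <- comul K y)
       (sigma (x1 ⊗ y1) * sigma ((x2 * y2) ⊗ z))) *: (v0 ⊗ (w0 ⊗ u0))).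
  transitivity (\swd_(x, v0 <- lcomod_coact V v)
    \swd_(y, w0 <- lcomod_coact W w)
    \swd_(x', v00 <- lcomod_coact V v0) \swd_(y', w00 <- lcomod_coact W w0)
    \swd_(z, u0 <- lcomod_coact U u)
    sigma (x ⊗ y) *: (sigma ((x' * y') ⊗ z) *: (v00 ⊗ (w00 ⊗ u0)))).
    rewrite (tens_act_pure sigma v w).
    have vL : linear (fun t : (V ⊗ W)%type =>
        tassoc (@tens_act (lctens V W) U sigma (t ⊗ u))).
      exact: lin_comp saL ((tensor_bilin _ _).2 u).
    rewrite (linear_swd _ _ vL); apply: eq_swd => x v0.
    rewrite (linear_swd _ _ vL); apply: eq_swd => y w0.
    rewrite (linZ vL) (@tens_act_pure (lctens V W)) /=.
    have dL : linear (fun t : (K ⊗ (V ⊗ W))%type =>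
        sigma (x ⊗ y) *: tassoc (\swd_(x', t0 <- t)
          \swd_(z, u0 <- lcomod_coact U u) sigma (x' ⊗ z) *: (t0 ⊗ u0))).
      by apply: lin_scaler; apply: (lin_comp asL); lin.
    rewrite diag_coact_pure (linear_swd _ _ dL); apply: eq_swd => x' v00.
    rewrite (linear_swd _ _ dL); apply: eq_swd => y' w00.
    rewrite swd_pure; last lin.
    rewrite (linear_swd _ _ asL) [LHS]linear_swd; last lin.
    by apply: eq_swd => z u0; rewrite (linZ asL) tassoc_pure.
  rewrite (@coact2_assoc _ _ _ (fun x y x' y' v w =>
    \swd_(z, u0 <- lcomod_coact U u)
      sigma (x ⊗ y) *: (sigma ((x' * y') ⊗ z) *: (v ⊗ (w ⊗ u0))))); try lin.
  apply: eq_swd => x v0; apply: eq_swd => y w0.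
  under eq_swd => x1 x2 do rewrite swd_exchange.
  rewrite swd_exchange; apply: eq_swd => z u0.
  rewrite [in RHS]/swd scaler_suml; apply: eq_bigr => p _.
  rewrite scaler_suml; apply: eq_bigr => q _.
  by rewrite scalerA.
under eq_swd => x v0.
  under eq_swd => y w0 do under eq_swd => z u0 do rewrite cocycleA.
  over.
transitivity (\swd_(x, v0 <- lcomod_coact V v)
  \swd_(y, w0 <- lcomod_coact W w) \swd_(z, u0 <- lcomod_coact U u)
  \swd_(y', w00 <- lcomod_coact W w0) \swd_(z', u00 <- lcomod_coact U u0)
  sigma (y ⊗ z) *: (sigma (x ⊗ (y' * z')) *: (v0 ⊗ (w00 ⊗ u00)))).
  apply: eq_swd => x v0.
  rewrite (@coact2_assoc _ _ _ (fun y z y' z' w u =>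
    sigma (y ⊗ z) *: (sigma (x ⊗ (y' * z')) *: (v0 ⊗ (w ⊗ u))))); try lin.
  apply: eq_swd => y w0; apply: eq_swd => z u0.
  rewrite [in LHS]/swd scaler_suml; apply: eq_bigr => p _.
  rewrite scaler_suml; apply: eq_bigr => q _.
  by rewrite scalerA.
rewrite (@tens_act_pure V (lctens W U)); apply: eq_swd => x v0.
have wL : linear (fun t : (W ⊗ U)%type =>
    \swd_(y, t0 <- diag_coact W U t) sigma (x ⊗ y) *: (v0 ⊗ t0)) by lin.
rewrite [lcomod_coact (lctens W U)]/= (tens_act_pure sigma w u).
rewrite (linear_swd _ _ wL).
apply: eq_swd => y w0; rewrite (linear_swd _ _ wL); apply: eq_swd => z u0.
have dL : linear (fun t : (K ⊗ (W ⊗ U))%type =>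
    \swd_(y, t0 <- t) sigma (x ⊗ y) *: (v0 ⊗ t0)) by lin.
rewrite (linZ wL) diag_coact_pure (linear_swd _ _ dL) linear_swd; last lin.
apply: eq_swd => y' w00; rewrite (linear_swd _ _ dL) linear_swd; last lin.
by apply: eq_swd => z' u00; rewrite swd_pure //; lin.
Qed.

End Comodules.

(** * The projection of A ⊗ A onto the balanced tensor product *)

Section AdditiveMaps.
Variable k : comPzRingType.

Lemma additive0 (M N : zmodType) (f : M -> N) :
  {morph f : t u / t + u} -> f 0 = 0.
Proof. by move=> fD; apply: (addIr (f 0)); rewrite -fD !add0r. Qed.

Lemma eq_additive_tens (M N : lmodType k) (Z : zmodType) (f g : M ⊗ N -> Z) :
    {morph f : t u / t + u} -> {morph g : t u / t + u} ->
  (forall m n, f (m ⊗ n) = g (m ⊗ n)) -> f =1 g.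
Proof.
move=> fD gD fg; elim/tens_ind => [|t u IHt IHu|//].
  by rewrite !additive0.
by rewrite fD gD IHt IHu.
Qed.

Lemma eq_additive_tens3 (M N P : lmodType k) (Z : zmodType)
    (f g : M ⊗ N ⊗ P -> Z) :
    {morph f : t u / t + u} -> {morph g : t u / t + u} ->
  (forall m n p, f (m ⊗ n ⊗ p) = g (m ⊗ n ⊗ p)) -> f =1 g.
Proof.
move=> fD gD fg; apply: eq_additive_tens => // t p; move: t.
apply: (@eq_additive_tens _ _ Z (fun t => f (t ⊗ p)) (fun t => g (t ⊗ p))) => //.
  by move=> t u; rewrite tensDl fD.
by move=> t u; rewrite tensDl gD.
Qed.

End AdditiveMaps.

Section BalancedProjection.
Variables (k : comPzRingType) (H : hopfAlg k) (R : rcomodAlg H).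

Definition bal_proj (t : R ⊗ R) : tensB R :=
  \swd_(a, a' <- t) btensor _ _ a a'.

(** A scalar c moves across the balanced tensor product because c *: 1 is
    coinvariant. *)
Lemma bal_proj_balanced : balanced (fun (a : R) (c : k) => c *: a)
  (fun (c : k) (a : R) => c *: a)
  (fun a a' : R => btensor _ _ a a' : tensB R).
Proof.
split=> [a a' b|a b b'|a c a'].
- exact: btensDl.
- exact: btensDr.
have c1P : (c *: (1 : R)) \in coinv R.
  by rewrite inE linearZ_LR (rcoact_morph R).1 tensZl.
have := btens_bal (fun (a : R) (b : coinvType R) => a * val b)
  (fun (b : coinvType R) (a : R) => val b * a) a (Coinv c1P) a'.
by rewrite /= -alg_scalerAr -alg_scalerAl mulr1 mul1r.
Qed.

Lemma bal_proj_pure a a' : bal_proj (a ⊗ a') = btensor _ _ a a'.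
Proof. exact: swdE bal_proj_balanced. Qed.

Lemma bal_projD : {morph bal_proj : t u / t + u}.
Proof. by move=> t u; apply: swdD bal_proj_balanced. Qed.

Lemma bal_proj_surj u : exists t, bal_proj t = u.
Proof.
exists (\sum_(p <- trepr u) p.1 ⊗ p.2); rewrite -[RHS]swd_btensor /swd.
elim: (trepr u) => [|p s IHs].
  by rewrite !big_nil (additive0 bal_projD).
by rewrite !big_cons bal_projD IHs bal_proj_pure.
Qed.

Lemma bal_proj_univ (Z : zmodType) (f : R ⊗ R -> Z) :
    {morph f : t u / t + u} ->
    (forall a (b : coinvType R) a',
      f ((a * val b) ⊗ a') = f (a ⊗ (val b * a'))) ->
  exists g : tensB R -> Z, forall t, g (bal_proj t) = f t.
Proof.
move=> fD fbal.
have fB : balanced (fun (a : R) (b : coinvType R) => a * val b)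
    (fun (b : coinvType R) (a : R) => val b * a) (fun a a' => f (a ⊗ a')).
  by split=> [a a' b|a b b'|a b a']; rewrite ?tensDl ?tensDr ?fD.
exists (fun u => \swd_(a, a' <- u) f (a ⊗ a')); apply: eq_additive_tens => //.
- by move=> t u; rewrite bal_projD swdD.
- by move=> a a'; rewrite bal_proj_pure swdE.
Qed.

End BalancedProjection.

(** * Twisting the canonical map *)

Section Bicomodule.
Variables (k : comPzRingType) (H K : hopfAlg k) (A : bicomodAlg K H).

(** The two coactions commute, in Sweedler form. *)
Lemma bicoact_swd (W : lmodType k) (f : K -> A -> H -> W) a : trilin f ->
  \swd_(a0, a1 <- rcoact A a) \swd_(x, a00 <- lcoact A a0) f x a00 a1 =
  \swd_(x, a0 <- lcoact A a) \swd_(a00, a1 <- rcoact A a0) f x a00 a1.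
Proof.
move=> fP.
transitivity (\swd_(u, a1 <- tmap (lcoact A) id (rcoact A a))
    \swd_(x, a00 <- u) f x a00 a1).
  by rewrite swd_tmap //; [lin | exact: trilinl].
rewrite -swd_tassoc // bicoactP swd_tmap //; [lin | exact: trilinr].
Qed.

End Bicomodule.

Section TwistedExtension.
Variables (k : comPzRingType) (H K : hopfAlg k) (A : bicomodAlg K H).
Variables (sigma : cocycle2 K) (tau : {scalar (K ⊗ K)%type}).
Hypothesis sigma_tau : forall g h,
  conv2 sigma tau g h = counit K g * counit K h.
Hypothesis tau_sigma : forall g h,
  conv2 tau sigma g h = counit K g * counit K h.
Variable rhoB : {linear coinvType A -> (K ⊗ coinvType A)%type}.
Hypothesis rhoBP : is_lcoaction rhoB.
Hypothesis rhoBE : forall b, tmap id val (rhoB b) = lcoact A (val b).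

Let CA : lcomod K := LComod (lcoactP A).
Let CB : lcomod K := LComod rhoBP.
Let B := coinvType A.

Let mulA (t : A ⊗ A) : A := \swd_(a, a' <- t) a * a'.

Let mulA_lin : linear mulA. Proof. by apply: swd_lin; lin. Qed.

Let mulA_pure a a' : mulA (a ⊗ a') = a * a'.
Proof. by rewrite /mulA swd_pure //; lin. Qed.

(** The product is a comodule map exactly because the left coaction is
    multiplicative. *)
Let mulA_colinear : @colinear _ K (lctens CA CA) CA mulA.
Proof.
split=> //=.
have tL : linear (tmap (@id K) mulA) by apply: tmap_lin; lin.
apply: eq_tens => [| |a b]; [by apply: lin_linear| |].
  exact: lin_comp tL (linearP (diag_coact CA CA)).
rewrite mulA_pure diag_coact_pure (lcoact_morph A).2.
rewrite -[_ * _]swd_tensor tens_mulE; last lin.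
rewrite (linear_swd _ _ tL); apply: eq_swd => x a0.
rewrite (linear_swd _ _ tL); apply: eq_swd => y b0.
by rewrite tmap_pure // mulA_pure.
Qed.

Let val_colinear : @colinear _ K CB CA val.
Proof. by split=> [|b]; [exact: linearP | rewrite /= rhoBE]. Qed.

Let twist_mulE (a b : A) :
  twist_mul sigma a b = mulA (@tens_act _ _ CA CA sigma (a ⊗ b)).
Proof.
rewrite tens_act_pure (linear_swd _ _ mulA_lin); apply: eq_swd => x a0.
rewrite (linear_swd _ _ mulA_lin); apply: eq_swd => y b0.
by rewrite (linZ mulA_lin) mulA_pure.
Qed.

Let mulAB : (A ⊗ B)%type -> A := mulA \o tmap id val.
Let mulBA : (B ⊗ A)%type -> A := mulA \o tmap val id.

Let mulAB_colinear : @colinear _ K (lctens CA CB) CA mulAB.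
Proof.
apply: (@colinear_comp _ K _ (lctens CA CA)) => //.
exact: (@colinear_tmap _ K CA CA CB CA (@id A) val (colinear_id _)).
Qed.

Let mulBA_colinear : @colinear _ K (lctens CB CA) CA mulBA.
Proof.
apply: (@colinear_comp _ K _ (lctens CA CA)) => //.
exact: (@colinear_tmap _ K CB CA CA CA val (@id A) _ (colinear_id _)).
Qed.

Let sA : rcomodAlg H := twist sigma A.
Let projT (t : A ⊗ A) : tensB sA := @bal_proj _ _ sA t.

(** The pair mulL, mulR \o tassoc presents A ⊗_B A as a coequalizer of maps
    A ⊗ B ⊗ A -> A ⊗ A.  Precomposed with sigL and sigR below, it presents the
    balanced tensor product of the twisted algebra. *)
Let mulL : (A ⊗ B ⊗ A)%type -> (A ⊗ A)%type := tmap mulAB id.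
Let mulR : (A ⊗ (B ⊗ A))%type -> (A ⊗ A)%type := tmap id mulBA.

Let mulL_lin : linear mulL.
Proof. exact: tmap_lin mulAB_colinear.1 (@lin_id _ _). Qed.
Let mulR_lin : linear mulR.
Proof. exact: tmap_lin (@lin_id _ _) mulBA_colinear.1. Qed.

Let sigL : (A ⊗ B ⊗ A)%type -> (A ⊗ B ⊗ A)%type :=
  tmap (@tens_act _ _ CA CB sigma) id.
Let sigR : (A ⊗ (B ⊗ A))%type -> (A ⊗ (B ⊗ A))%type :=
  tmap id (@tens_act _ _ CB CA sigma).
Let sigmaAA : (A ⊗ A)%type -> (A ⊗ A)%type := @tens_act _ _ CA CA sigma.
Let tauAA : (A ⊗ A)%type -> (A ⊗ A)%type := @tens_act _ _ CA CA tau.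

Let sigL_lin : linear sigL.
Proof. exact: tmap_lin (@tens_act_lin _ _ CA CB sigma) (@lin_id _ _). Qed.
Let sigR_lin : linear sigR.
Proof. exact: tmap_lin (@lin_id _ _) (@tens_act_lin _ _ CB CA sigma). Qed.

(** By coherence this is also, up to reassociation, sigR followed by the action
    of sigma on A ⊗ (B ⊗ A), which is why the same map serves sigma_mulL and sigma_mulR. *)
Let omega : (A ⊗ B ⊗ A)%type -> (A ⊗ B ⊗ A)%type :=
  @tens_act _ _ (lctens CA CB) CA sigma \o sigL.

Let assocL : linear (fun t : (A ⊗ B ⊗ A)%type => tassoc t).
Proof. exact: tassoc_lin. Qed.

Let sigma_mulL t : sigmaAA (mulL (sigL t)) = mulL (omega t).
Proof.
exact: (@tens_act_natural _ _ (lctens CA CB) CA CA CA sigma mulAB id _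
  mulAB_colinear (colinear_id _)).
Qed.

Let sigma_mulR t :
  sigmaAA (mulR (sigR (tassoc t))) = mulR (tassoc (omega t)).
Proof.
rewrite /omega /= (@tens_act_cocycle _ _ CA CB CA).
exact: (@tens_act_natural _ _ CA CA (lctens CB CA) CA sigma id mulBA _
  (colinear_id _) mulBA_colinear).
Qed.

Let mulL_pure a b a' : mulL (a ⊗ b ⊗ a') = (a * val b) ⊗ a'.
Proof.
rewrite /mulL tmap_pure //; last exact: mulAB_colinear.1.
by rewrite /mulAB /= tmap_pure ?mulA_pure //; exact: linearP.
Qed.

Let mulR_pure a b a' : mulR (a ⊗ (b ⊗ a')) = a ⊗ (val b * a').
Proof.
rewrite /mulR tmap_pure //; last exact: mulBA_colinear.1.
by rewrite /mulBA /= tmap_pure ?mulA_pure //; exact: linearP.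
Qed.

Let mulL_sigL a b a' :
  mulL (sigL (a ⊗ b ⊗ a')) = twist_mul sigma a (val b) ⊗ a'.
Proof.
rewrite /mulL /sigL !tmap_pure //; try exact: tens_act_lin.
  rewrite /mulAB /= -(@tens_act_natural _ _ CA CA CB CA) //;
    last exact: colinear_id.
  by rewrite tmap_pure ?twist_mulE //; exact: linearP.
exact: mulAB_colinear.1.
Qed.

Let mulR_sigR a b a' :
  mulR (sigR (a ⊗ (b ⊗ a'))) = a ⊗ twist_mul sigma (val b) a'.
Proof.
rewrite /mulR /sigR !tmap_pure //; try exact: tens_act_lin.
  rewrite /mulBA /= -(@tens_act_natural _ _ CB CA CA CA) //;
    last exact: colinear_id.
  by rewrite tmap_pure ?twist_mulE //; exact: linearP.
exact: mulBA_colinear.1.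
Qed.

Let proj_mulL t : bal_proj (mulL t) = bal_proj (mulR (tassoc t)).
Proof.
move: t; apply: eq_additive_tens3.
- by move=> t u; rewrite (linD mulL_lin) bal_projD.
- by move=> t u; rewrite (linD assocL) (linD mulR_lin) bal_projD.
move=> a b a'; rewrite tassoc_pure mulL_pure mulR_pure.
by rewrite !bal_proj_pure btens_bal.
Qed.

Let projT_mulL t :
  projT (mulL (sigL t)) = projT (mulR (sigR (tassoc t))).
Proof.
move: t; apply: eq_additive_tens3.
- by move=> t u; rewrite (linD sigL_lin) (linD mulL_lin) [projT _]bal_projD.
- move=> t u; rewrite (linD assocL) (linD sigR_lin).
  by rewrite (linD mulR_lin) [projT _]bal_projD.
move=> a b a'; rewrite tassoc_pure mulL_sigL mulR_sigR.
rewrite /projT !(@bal_proj_pure _ _ sA).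
(* A and its twist have the same coinvariant elements but distinct types of
   coinvariants, so b is repackaged. *)
exact: (@btens_bal _ _ _ (fun (a : sA) (b : coinvType sA) => a * val b)
  (fun (b : coinvType sA) (a : sA) => val b * a) a
  (@Coinv _ _ sA (val b) (coinv_valP b)) a').
Qed.

Let sigmaK : cancel sigmaAA tauAA.
Proof. exact: (@tens_actK _ _ CA CA tau sigma sigma_tau). Qed.

Let tauK : cancel tauAA sigmaAA.
Proof. exact: (@tens_actK _ _ CA CA sigma tau tau_sigma). Qed.

Let sigmaAA_lin : linear sigmaAA. Proof. exact: (@tens_act_lin _ _ CA CA). Qed.
Let tauAA_lin : linear tauAA. Proof. exact: (@tens_act_lin _ _ CA CA). Qed.

Let omega_surj t : exists z, omega z = t.
Proof.
exists (tmap (@tens_act _ _ CA CB tau) id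
  (@tens_act _ _ (lctens CA CB) CA tau t)).
rewrite /omega /= /sigL.
rewrite (@tmap_cancel_l _ _ _ _ _ _ (@tens_act_lin _ _ CA CB tau)
  (@tens_act_lin _ _ CA CB sigma)).
  exact: (@tens_actK _ _ (lctens CA CB) CA sigma tau tau_sigma).
exact: (@tens_actK _ _ CA CB sigma tau tau_sigma).
Qed.

(** The map As ⊗_Bs As -> A ⊗_B A: a twisted relation on A ⊗ A is sent by sigma
    to the relation indexed by its image under omega. *)
Let proj_sigma : exists g : tensB sA -> tensB A,
  forall t, g (projT t) = bal_proj (sigmaAA t).
Proof.
apply: (@bal_proj_univ _ _ sA _ (fun t => bal_proj (sigmaAA t))).
  by move=> t u; rewrite (linD sigmaAA_lin) bal_projD.
move=> a b a'; pose b0 : B := @Coinv _ _ A (val b) (coinv_valP b).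
have := proj_mulL (omega (a ⊗ b0 ⊗ a')).
by rewrite -sigma_mulL -sigma_mulR tassoc_pure mulL_sigL mulR_sigR.
Qed.

(** The inverse map.  No identity for tau is involved: each relation of
    A ⊗_B A is indexed by some omega z, hence is the image under sigma of the
    twisted relation indexed by z, to which tau sends it back. *)
Let proj_tau : exists g : tensB A -> tensB sA,
  forall t, g (bal_proj t) = projT (tauAA t).
Proof.
apply: bal_proj_univ.
  by move=> t u; rewrite (linD tauAA_lin) [projT _]bal_projD.
move=> a b a'.
rewrite -mulL_pure -mulR_pure -tassoc_pure.
have [z <-] := omega_surj (a ⊗ b ⊗ a').
by rewrite -sigma_mulL -sigma_mulR !sigmaK projT_mulL.
Qed.

(** The canonical map before passing to the quotient; being k-linear on A ⊗ A,
    it can be computed through Sweedler sums, unlike can, whose source is only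
    an abelian group. *)
Let can_free (t : A ⊗ A) : (A ⊗ H)%type :=
  \swd_(a, a' <- t) \swd_(a'0, h <- rcoact A a') (a * a'0) ⊗ h.

Let can_free_lin : linear can_free.
Proof. by apply: swd_lin; lin. Qed.

Let can_proj (t : A ⊗ A) : can (bal_proj t) = can_free t.
Proof.
move: t; apply: eq_additive_tens.
- by move=> t u; rewrite bal_projD canD.
- exact: linD can_free_lin.
- by move=> a a'; rewrite bal_proj_pure canE /can_free swd_pure //; lin.
Qed.

(** The coaction of H on a' may be taken before or after the coaction of K
    that feeds sigma, since the two coactions commute. *)
Let can_projT t : can (projT t) = can (bal_proj (sigmaAA t)).
Proof.
rewrite can_proj; move: t; apply: eq_additive_tens.
- by move=> t u; rewrite [projT _]bal_projD canD.
- exact: linD (lin_comp can_free_lin sigmaAA_lin).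
move=> a a'; rewrite [projT _](@bal_proj_pure _ _ sA) canE.
rewrite /sigmaAA tens_act_pure (linear_swd _ _ can_free_lin).
transitivity (\swd_(c, h <- rcoact A a') (twist_mul sigma a c) ⊗ h); first by [].
transitivity (\swd_(x, a0 <- lcoact A a) \swd_(c, h <- rcoact A a')
  \swd_(y, c0 <- lcoact A c) sigma (x ⊗ y) *: ((a0 * c0) ⊗ h)).
  rewrite swd_exchange; apply: eq_swd => c h.
  rewrite /twist_mul [LHS](linear_swd (L := fun u => u ⊗ h)); last lin.
  apply: eq_swd => x a0; rewrite (linear_swd (L := fun u => u ⊗ h)); last lin.
  by apply: eq_swd => y c0; rewrite tensZl.
apply: eq_swd => x a0; rewrite bicoact_swd; last lin.
rewrite (linear_swd _ _ can_free_lin); apply: eq_swd => y c0.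
rewrite (linZ can_free_lin) /can_free swd_pure; last lin.
by rewrite linear_swd //; lin.
Qed.

Lemma hopf_galois_twist : hopf_galois A <-> hopf_galois (twist sigma A).
Proof.
have [phi phiE] := proj_sigma; have [psi psiE] := proj_tau.
have phiK : cancel phi psi.
  by move=> u; have [t <-] := bal_proj_surj u; rewrite phiE psiE sigmaK.
have psiK : cancel psi phi.
  by move=> u; have [t <-] := bal_proj_surj u; rewrite psiE phiE tauK.
have can_phi u : can (phi u) = can u.
  by have [t <-] := bal_proj_surj u; rewrite phiE -can_projT.
split=> canP.
  by apply: (eq_bij (bij_comp canP (Bijective phiK psiK))).
apply: (eq_bij (bij_comp canP (Bijective psiK phiK))) => u /=.
by rewrite -can_phi psiK.
Qed.

End TwistedExtension.

Theorem corollary3p16 (k : comPzRingType) (H K : hopfAlg k)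
    (A : bicomodAlg K H) (hB : coinv_subcomodule A) (sigma : cocycle2 K) :
  hopf_galois A <-> hopf_galois (twist sigma A).
Proof.
have [rhoB [rhoBP rhoBE]] := hB; have [tau tauP] := cocycle_inv sigma.
apply: (hopf_galois_twist _ _ rhoBP rhoBE) => g h.
- exact: (tauP g h).1.
- exact: (tauP g h).2.
Qed.
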